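(* Let $p$ be an odd prime and let $\lambda,l$ be positive integers with $2\le l\le p/2$ and $\lambda(2p-1)=l^2$. Suppose $\lambda$ has a prime factor $q$ which is a primitive root modulo $p$. Then there is no $(2p,2,l;\lambda)$-SEDF in any abelian group of order $2p$.
   Context: Let $(G,\cdot)$ be a finite abelian group of order $n$. A pair $\{A_0,A_1\}$ of disjoint subsets of $G$ with $|A_0|=|A_1|=l$ is an $(n,2,l;\lambda)$-strong external difference family (SEDF) in $G$ if $A_0A_1^{(-1)}=\lambda(G-1_G)$ and $A_1A_0^{(-1)}=\lambda(G-1_G)$ in the group ring $\mathbb{Z}[G]$, i.e. every $g\ne1_G$ occurs exactly $\lambda$ times, and $1_G$ does not occur, in the multiset $\{\{ab^{-1}:a\in A_0,b\in A_1\}\}$ (and likewise with $A_0,A_1$ swapped). *)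

(* Defs.v *)
From mathcomp Require Import all_boot all_order all_algebra all_fingroup.
Set Implicit Arguments.
Unset Strict Implicit.
Unset Printing Implicit Defensive.

Local Open Scope group_scope.

(* The multiplicity of g in the multiset {{ a b^-1 : a in A, b in B }}, that
   is, the coefficient of g in the group ring product A B^(-1). *)
Definition ext_diff_mult (gT : finGroupType) (A B : {set gT}) (g : gT) : nat :=
  #|[set ab in setX A B | ab.1 * ab.2^-1 == g]|.

(* A B^(-1) = lam (G - 1) in Z[G]; for A and B inside G no element outside G
   occurs in the product, so comparing coefficients on G is enough. *)
Definition ext_diff_eq (gT : finGroupType) (G : {group gT}) (lam : nat)
    (A B : {set gT}) : Prop :=
  forall g : gT, g \in G ->
    ext_diff_mult A B g = if g == 1 then 0%N else lam.

(* The (n, m, l; lam)-strong external difference families with m = 2. *)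
Definition is_sedf2 (gT : finGroupType) (G : {group gT}) (n l lam : nat)
    (A0 A1 : {set gT}) : Prop :=
  [/\ #|G| = n,
      A0 \subset G /\ A1 \subset G,
      [disjoint A0 & A1],
      #|A0| = l /\ #|A1| = l &
      ext_diff_eq G lam A0 A1 /\ ext_diff_eq G lam A1 A0].

Definition primitive_root_mod (p q : nat) : Prop :=
  ((p.-1).-primitive_root (q%:R : 'F_p))%R.

(* Main.v *)
Require Import Defs.
From mathcomp Require Import all_boot all_order all_algebra all_fingroup.
From mathcomp Require Import cyclic pgroup finfield.

(** Reduce modulo q instead of using complex characters.  Let L be the field
    with q^(p-1) elements and chi a character of G of order p with values in
    the units of L; its kernel is {1, t} with t the involution of G.  Since q
    divides lam, the equation A0 A1^(-1) = lam (G - 1) gives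
    chi(A0) chi^-1(A1) = 0 in L, so one of the two factors vanishes.  As q is a
    primitive root mod p, the Frobenius map moves chi to all its nontrivial
    powers, hence all of them vanish on that set A, and Fourier inversion shows
    that #|A :&: h{1, t}| mod q does not depend on h.  If some coset of {1, t}
    met A in one point, A would meet every coset and have at least p elements;
    so A is a union of cosets of {1, t}.  But then t = a b^-1 with a in A0 and
    b in A1 puts a common element in A0 and A1. *)

Import GRing.Theory.

Local Open Scope ring_scope.

(** By Fermat, [k] is a (p-1)-th root of unity in ['F_p], hence a power of the primitive root
    [q]. *)
Lemma primitive_root_mod_surj {p q k : nat} : prime p ->
  primitive_root_mod p q -> ~~ (p %| k)%N ->
  exists j, (q ^ j)%N = k %[mod p].
Proof.
move=> p_pr prim_q p'k.
have k_neq0 : (k%:R : 'F_p) != 0.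
  by rewrite -(dvdn_pcharf (pchar_Fp p_pr)).
have k_unity : (k%:R : 'F_p) ^+ p.-1 = 1.
  apply: (mulIf k_neq0); rewrite -exprSr prednK ?prime_gt0 // mul1r.
  by have := expf_card (k%:R : 'F_p); rewrite card_Fp.
have [j kE] := prim_rootP prim_q k_unity.
exists j; rewrite -!(val_Fp_nat p_pr); congr (val _).
by rewrite natrX kE.
Qed.

Lemma finField_unit_order (p q n : nat) : prime p -> prime q -> (0 < n)%N ->
  (p %| (q ^ n).-1)%N ->
  exists (L : finFieldType) (u : {unit L}), q \in [pchar L] /\ #[u]%g = p.
Proof.
move=> p_pr q_pr n_gt0 p_dvd.
have [L charL cardL] := pPrimePowerField q_pr n_gt0.
have : (p %| #|[set: {unit L}]%g|)%N by rewrite card_finField_unit cardL.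
by case/(Cauchy p_pr) => u _ ou; exists L, u.
Qed.

Lemma expr_sum_pchar (R : comNzRingType) (q j : nat) (I : finType)
    (P : pred I) (F : I -> R) : q \in [pchar R] ->
  (\sum_(i | P i) F i) ^+ (q ^ j) = \sum_(i | P i) F i ^+ (q ^ j).
Proof.
move=> charR; have q_pr := pcharf_prime charR.
apply: (big_morph (fun x : R => x ^+ (q ^ j))) => [x y|].
  apply: exprDn_pchar; rewrite (eq_pnat _ (pcharf_eq charR)).
  by rewrite pnatX pnat_id.
by rewrite expr0n gtn_eqF // expn_gt0 prime_gt0.
Qed.

Lemma sum_unity_root (F : fieldType) (p : nat) (z : F) : z ^+ p = 1 ->
  \sum_(k < p) z ^+ k = if z == 1 then p%:R else 0.
Proof.
move=> zp1; have [->|z_neq1] := eqVneq z 1.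
  by under eq_bigr do rewrite expr1n; rewrite sumr_const card_ord.
apply: (mulfI (_ : z - 1 != 0)); first by rewrite subr_eq0.
by rewrite mulr0 -subrX1 zp1 subrr.
Qed.

Section ModularCharacter.

Variables (gT : finGroupType) (G : {group gT}) (L : finFieldType).
Variable chi : {morphism G >-> {unit L}}.

(** Expanding the product and grouping the pairs by their quotient g, each g contributes [chi g]
    with multiplicity 0 or [lam], and [lam] is zero in [L] because [q] divides it. *)
Lemma modular_char_ext_diff (A B : {set gT}) (lam q : nat) :
    A \subset G -> B \subset G -> ext_diff_eq G lam A B ->
    q \in [pchar L] -> (q %| lam)%N ->
  (\sum_(a in A) val (chi a)) * (\sum_(b in B^-1%g) val (chi b)) = 0.
Proof.
move=> sAG sBG diffAB charL q_lam.
have lam0 : lam%:R = 0 :> L by apply/eqP; rewrite -(dvdn_pcharf charL).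
rewrite [X in _ * X](reindex_inj invg_inj) /=.
under [X in _ * X]eq_bigl do rewrite mem_invg invgK.
rewrite big_distrlr pair_big /=.
have inG ab : (ab.1 \in A) && (ab.2 \in B) -> (ab.1 * ab.2^-1 \in G)%g.
  by case/andP=> Aa Bb; rewrite groupM ?groupV ?(subsetP sAG _ Aa) ?(subsetP sBG _ Bb).
rewrite (partition_big (fun ab => ab.1 * ab.2^-1)%g (mem G)) //=.
apply: big1 => g Gg.
transitivity (\sum_(ab in [set ab in setX A B | (ab.1 * ab.2^-1 == g)%g])
                val (chi g)).
  apply: eq_big => [ab|ab /andP[/andP[Aa Bb] /eqP <-]].
    by rewrite !inE.
  by rewrite morphM ?groupV ?(subsetP sAG _ Aa) ?(subsetP sBG _ Bb).
rewrite sumr_const -/(ext_diff_mult A B g) diffAB //.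
by case: ifP => _; rewrite ?mulr0n // -mulr_natr lam0 mulr0.
Qed.

(** Fourier inversion over the powers of [chi]. Keeping the factor [p] on the left avoids dividing
    in [L]; the right-hand side does not depend on [h]. *)
Lemma modular_char_fibre_card (A : {set gT}) (p q : nat) :
    prime p -> A \subset G -> {in G, forall g, chi g ^+ p = 1}%g ->
    q \in [pchar L] -> primitive_root_mod p q ->
    \sum_(a in A) val (chi a) = 0 ->
  {in G, forall h, p%:R * #|[set a in A | chi a == chi h]|%:R = #|A|%:R :> L}.
Proof.
move=> p_pr sAG chi_p charL prim_q sum0 h Gh.
have val_chi_p g : g \in G -> val (chi g) ^+ p = 1.
  by move=> Gg; rewrite -FinRing.val_unitX chi_p.
have power_sum0 (k : 'I_p) : val k != 0%N -> \sum_(a in A) val (chi a) ^+ k = 0.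
  move=> k_neq0.
  have p'k : ~~ (p %| k)%N by rewrite gtnNdvd // lt0n.
  have [j kE] := primitive_root_mod_surj p_pr prim_q p'k.
  (* Choosing [j] with q^j = k mod p turns the k-th power sum into a Frobenius image of the
     vanishing sum. *)
  transitivity ((\sum_(a in A) val (chi a)) ^+ (q ^ j)).
    rewrite expr_sum_pchar //; apply: eq_bigr => a Aa.
    have chia_p := val_chi_p _ (subsetP sAG _ Aa).
    by rewrite -(expr_mod (q ^ j) chia_p) kE expr_mod.
  by rewrite sum0 expr0n gtn_eqF // expn_gt0 prime_gt0 ?(pcharf_prime charL).
(* Orthogonality: the inner sum is [p] when [chi a = chi h] and 0 otherwise. *)
transitivity (\sum_(a in A) \sum_(k < p) (val (chi a) / val (chi h)) ^+ k).
  rewrite mulr_natr cardsE -sumr_const big_mkcondr /=.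
  apply: eq_bigr => a Aa.
  rewrite sum_unity_root; last first.
    by rewrite expr_div_n !val_chi_p ?(subsetP sAG a Aa) // divr1.
  have chih_neq0 : val (chi h) != 0 by rewrite -unitfE (valP (chi h)).
  have chiV_neq0 : (val (chi h))^-1 != 0 by rewrite invr_eq0.
  rewrite -[X in _ = if _ == X then _ else _](divff chih_neq0).
  by rewrite (inj_eq (mulIf chiV_neq0)) (inj_eq val_inj).
rewrite exchange_big /=.
(* After the exchange only k = 0 survives, and it counts [A]. *)
rewrite (bigD1 (Ordinal (prime_gt0 p_pr))) //= [X in _ + X]big1 ?addr0.
  by under eq_bigr do rewrite expr0; rewrite sumr_const.
move=> k k_neq0.
under eq_bigr do rewrite expr_div_n.
by rewrite -mulr_suml power_sum0 ?mul0r.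
Qed.

End ModularCharacter.

Local Close Scope ring_scope.
Local Open Scope group_scope.

Section Order2p.

Variables (p q : nat) (gT : finGroupType) (G : {group gT}) (t : gT).
Variables (L : finFieldType) (chi : {morphism G >-> {unit L}}).
Hypotheses (p_pr : prime p) (Gt : t \in G) (ot : #[t] = 2).
Hypotheses (cardG : #|G| = (2 * p)%N) (ker_chi : 'ker chi = <[t]>).
Hypotheses (chi_p : {in G, forall g, chi g ^+ p = 1}).
Hypotheses (charL : q \in [pchar L]%R) (prim_q : primitive_root_mod p q).

Lemma chi_fibreE (h a : gT) : h \in G -> a \in G ->
  (chi a == chi h) = (a == h) || (a == t * h).
Proof.
move=> Gh Ga; apply/eqP/idP => [chiE|]; last first.
  case/orP=> /eqP-> //; rewrite morphM //.
  have /mker-> : t \in 'ker chi by rewrite ker_chi cycle_id.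
  by rewrite mul1g.
have : a * h^-1 \in 'ker chi.
  apply/kerP; first by rewrite groupM ?groupV.
  by rewrite morphM ?morphV ?groupV // chiE mulgV.
rewrite ker_chi cycle2g // !inE => /orP[]/eqP aE.
  by rewrite -[a](mulgKV h) aE mul1g eqxx.
by rewrite -[a](mulgKV h) aE eqxx orbT.
Qed.

(** If [q] were [p], it would be 0 in ['F_p], which is no root of unity. This makes [p] invertible
    in [L]. *)
Lemma prime_order_not_pchar : ~~ (q %| p).
Proof.
have q_pr := pcharf_prime charL.
rewrite dvdn_prime2 //; apply/eqP => qE.
have := prim_expr_order prim_q; rewrite qE pchar_Fp_0 // expr0n.
by rewrite -subn1 subn_eq0 leqNgt prime_gt1.
Qed.

Lemma modular_char_vanish_stable (A : {set gT}) :
    A \subset G -> #|A| < p -> (\sum_(a in A) val (chi a) = 0)%R ->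
  {in A, forall a, t * a \in A}.
Proof.
move=> sAG ltAp sum0 a Aa; apply: contraTT ltAp => A'ta; rewrite -leqNgt.
have p_neq0 : (p%:R != 0 :> L)%R.
  by rewrite -(dvdn_pcharf charL) prime_order_not_pchar.
(* Without [t * a], the fibre through [a] is a singleton, so #|A| equals [p] in [L], which is
   nonzero; then no fibre is empty, [A] and [t *: A] cover [G], and 2p <= 2 #|A|. *)
have fibre_a : [set b in A | chi b == chi a] = [set a].
  apply/setP=> b; rewrite !inE; case Ab: (b \in A) => /=; last first.
    by apply/esym/negbTE; apply: contraFneq Ab => ->.
  rewrite chi_fibreE ?(subsetP sAG) //.
  by case: (b =P t * a) => [bE|_]; rewrite ?orbF //; rewrite bE (negPf A'ta) in Ab.
have sGA : G \subset A :|: t *: A.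
  apply/subsetP => h Gh.
  have fibreE := modular_char_fibre_card _ _ _ chi _ _ _ p_pr sAG chi_p charL
    prim_q sum0.
  have : #|[set b in A | chi b == chi h]| != 0.
    apply/eqP => fibre_h; have := fibreE a (subsetP sAG _ Aa).
    rewrite -(fibreE h Gh) fibre_h fibre_a cards1 mulr1 mulr0.
    by move/eqP; rewrite (negPf p_neq0).
  rewrite cards_eq0 => /set0Pn[b]; rewrite !inE => /andP[Ab].
  rewrite chi_fibreE ?(subsetP sAG b Ab) // => /orP[]/eqP bE; first by rewrite -bE Ab.
  by rewrite mem_lcoset invg2id // -bE Ab orbT.
have := leq_trans (subset_leq_card sGA) (leq_card_setU _ _).
by rewrite card_lcoset cardG addnn -mul2n leq_pmul2l.
Qed.

End Order2p.

Local Close Scope group_scope.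

Theorem theorem8 (p lam l : nat) (p_prime : prime p) (p_odd : odd p)
    (lam_gt0 : 0 < lam) (l_ge2 : 2 <= l) (l_le : 2 * l <= p)
    (lam_l : lam * (2 * p - 1) = l ^ 2)
    (lam_factor : exists q : nat,
        [/\ prime q, q %| lam & primitive_root_mod p q])
    (gT : finGroupType) (G : {group gT}) (G_abelian : abelian G)
    (G_order : #|G| = 2 * p) :
  ~ exists A0 A1 : {set gT}, is_sedf2 G (2 * p) l lam A0 A1.
Proof.
case: lam_factor => q [q_pr q_lam prim_q].
case=> A [B [_ [sAG sBG] disAB [cardA cardB] [diffAB _]]].
have p_gt1 := prime_gt1 p_prime.
have p_dvd : p %| (q ^ p.-1).-1.
  have := prim_expr_order prim_q; rewrite -natrX => q1.
  have : q ^ p.-1 == 1 %[mod p] by rewrite -!(val_Fp_nat p_prime) q1.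
  by rewrite eqn_mod_dvd ?expn_gt0 ?prime_gt0 // subn1.
have [|L [u [charL ou]]] := finField_unit_order _ _ _ p_prime q_pr _ p_dvd.
  by rewrite -subn1 subn_gt0.
(* The product of commuting elements of coprime orders 2 and [p] generates [G]. *)
have [z oz Gz] : exists2 z, #[z]%g = (2 * p)%N & G = <[z]>%G.
  have [||t Gt ot] := @Cauchy _ 2 G; rewrite ?G_order ?dvdn_mulr //.
  have [||y Gy oy] := @Cauchy _ p G; rewrite ?G_order ?dvdn_mull //.
  have oty : #[t * y]%g = (2 * p)%N.
    rewrite orderM ?ot ?oy ?coprime2n //.
    exact: (centsP G_abelian).
  exists (t * y)%g => //; apply/val_inj/esym/eqP.
  by rewrite eqEcard cycle_subG groupM //= G_order -orderE oty.
have u_dvd_z : #[u]%g %| #[z]%g by rewrite ou oz dvdn_mull.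
(* [chi] sends z^i to u^i, so its kernel is generated by z^p, the involution [t]. *)
pose chi := [morphism of eltm u_dvd_z].
pose t := (z ^+ p)%g.
have ot : #[t]%g = 2 by rewrite orderXdiv oz ?dvdn_mull // mulnK ?prime_gt0.
have ker_chi : ('ker chi = <[t]>)%g by rewrite ker_eltm ou.
rewrite {}Gz in G_order G_abelian sAG sBG diffAB *.
have Gt : t \in <[z]>%G by rewrite mem_cycle.
have chi_p : {in <[z]>%G, forall g, chi g ^+ p = 1}%g.
  move=> _ /cycleP[i ->]; rewrite /chi /= eltmE -expgM mulnC expgM.
  by rewrite -ou expg_order expg1n.
have stable := modular_char_vanish_stable _ _ _ _ _ _ _ p_prime Gt ot G_order
  ker_chi chi_p charL prim_q.
have ltlp : l < p.
  by apply: leq_trans l_le; rewrite mul2n -addnn -[X in X < _]addn0 ltn_add2l ltnW.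
(* Since [t] is not 1, it occurs [lam] > 0 times as a quotient. *)
have [[a b]] : exists ab : gT * gT,
    ab \in [set ab in setX A B | (ab.1 * ab.2^-1)%g == t].
  apply/set0Pn; rewrite -card_gt0 -/(ext_diff_mult A B t) diffAB //.
  by case: eqP ot => [->|//]; rewrite order1.
rewrite !inE /= => /andP[/andP[Aa Bb] /eqP abE].
have aE : a = (t * b)%g by rewrite -abE mulgKV.
have [] : ((\sum_(a in A) val (chi a)) = 0 \/
           (\sum_(b in B^-1%g) val (chi b)) = 0)%R.
  have /eqP := modular_char_ext_diff _ _ _ chi _ _ _ _ sAG sBG diffAB charL q_lam.
  by rewrite mulf_eq0 => /orP[]/eqP; [left|right].
(* If [A] is stable under [t], then t a = t t b = b lies in [A] as well as in [B]. *)
- move/(stable A sAG); rewrite cardA => /(_ ltlp a Aa).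
  rewrite aE mulgA -expg2 -ot expg_order mul1g => Ab.
  by rewrite (disjointFr disAB Ab) in Bb.
(* If B^-1 is stable, it contains t b^-1, whose inverse b t = t b = a then lies in [B] as well as in
   [A]. *)
- move/(stable B^-1%g); rewrite -invGid invSg card_invg cardB.
  move=> /(_ sBG ltlp b^-1%g); rewrite !mem_invg invgK invMg invgK.
  rewrite invg2id // => /(_ Bb) Bbt.
  rewrite -(centsP G_abelian _ Gt _ (subsetP sBG _ Bb)) -aE in Bbt.
  by rewrite (disjointFr disAB Aa) in Bbt.
Qed.
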